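(* Let $A<\infty$, $\alpha>0$ and $K<\infty$. There exists a constant $C_V<\infty$, depending only on $A,K,\alpha$, such that the following holds. Let $P$ be an irreducible reversible Markov kernel on a countable state space $V$, with reversible measure $m$, satisfying $\mathrm{LH}(A)$, and suppose \[ \sup_{x\in V}\mathbb E_x\,\mathrm{dist}(x,X_t)^\alpha\le K t^{\alpha/2}\qquad\text{for all } t\ge1 . \] Then \[ \mathrm{Vol}(B(x,2r))\le C_V\,\mathrm{Vol}(B(x,r))\qquad\text{for all } x\in V,\ r\ge0 . \]
   Context: $P$ is reversible if there is a strictly positive $m:V\to(0,\infty)$ (a reversible measure) with $m(x)P(x,y)=m(y)P(y,x)$ for all $x,y\in V$. The distance is $\mathrm{dist}(x,y)=\min\{k\ge0:P^k(x,y)>0\}$; $B(x,r)=\{y\in V:\mathrm{dist}(x,y)\le r\}$; $\mathrm{Vol}(S)=\sum_{z\in S}m(z)$ for $S\subseteq V$. $(X_t)_{t\ge0}$ is the continuous-time chain with generator $L=P-I$, so that $\mathbb P_x(X_t=y)=P_t(x,y)=e^{-t}\sum_{k\ge0}\frac{t^k}{k!}P^k(x,y)$ ($(P_t)$ is the heat semigroup); $\mathbb E_x$ is expectation for the chain started at $X_0=x$. $D(\mu\|\nu)=\int\log(d\mu/d\nu)\,d\mu$ if $\mu\ll\nu$ and $+\infty$ otherwise is relative entropy. $P$ satisfies $\mathrm{LH}(A)$ if, for all $x,y\in V$ and $t>0$, \[ D(P_t(x,\cdot)\|P_t(y,\cdot))\le A\left(\frac{\mathrm{dist}(x,y)^2}{t}+\frac{\mathrm{dist}(x,y)}{\sqrt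 t}\right). \] *)

(* Defs.v *)
From HB Require Import structures.
From mathcomp Require Import all_boot all_order all_algebra.
From mathcomp Require Import all_classical all_reals all_analysis.

Set Implicit Arguments.
Unset Strict Implicit.
Unset Printing Implicit Defensive.

Import Order.TTheory GRing.Theory Num.Theory.
Import numFieldNormedType.Exports.

Local Open Scope classical_set_scope.
Local Open Scope ring_scope.
Local Open Scope ereal_scope.
Local Open Scope charge_scope.

(* The state space is a measurableType in which every set is measurable and
   whose carrier is countable (both are hypotheses of the theorem); a Markov
   kernel is then a probability kernel P : R.-pker V ~> V, and P(x, y) is
   P x [set y]. *)

Section kernel_powers.
Context d (V : measurableType d) (R : realType).

Section composition.
Variables k1 k2 : R.-pker V ~> V.

Let prob_mkcomp_noparam x : mkcomp_noparam k1 k2 x [set: V] = 1.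
Proof.
rewrite /mkcomp_noparam /= /kcomp_noparam.
under eq_integral do rewrite prob_kernel.
by rewrite integral_cst// mul1e prob_kernel.
Qed.

HB.instance Definition _ := Kernel_isProbability.Build _ _ _ _ R
  (mkcomp_noparam k1 k2) prob_mkcomp_noparam.

Definition kcomp_prob : R.-pker V ~> V := mkcomp_noparam k1 k2.

End composition.

(* P^0(x, .) is the Dirac mass at x, P^(k+1)(x, .) = \int P(x, dz) P^k(z, .). *)
Fixpoint kpow (P : R.-pker V ~> V) (k : nat) : R.-pker V ~> V :=
  if k is k'.+1 then kcomp_prob P (kpow P k')
  else kdirac (@measurable_id _ V [set: V]).

End kernel_powers.

Section heat_semigroup.
Context d (V : measurableType d) (R : realType).
Variables (P : R.-pker V ~> V) (t : {nonneg R}) (x : V).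

(* P_t(x, .) = e^-t \sum_k (t^k / k!) P^k(x, .), the law of X_t under P_x. *)
Definition heat : set V -> \bar R :=
  mscale ((expR (- t%:num))%:nng)%R
    (mseries (fun k => mscale ((t%:num ^+ k / k`!%:R)%:nng)%R (kpow P k x)) 0).

HB.instance Definition _ := Measure.on heat.

Let heat_setT : heat [set: V] = 1.
Proof.
rewrite /heat [LHS]/mscale /= /mseries.
rewrite (eq_eseriesr (g := fun k => (t%:num ^+ k / k`!%:R)%:E)); last first.
  by move=> k _; rewrite -[RHS]mule1 -(@prob_kernel _ _ _ _ _ (kpow P k) x).
rewrite -[RHS](_ : (expR (- t%:num))%:E * (expR t%:num)%:E = 1); last first.
  by rewrite -EFinM expRN mulVf ?gt_eqF ?expR_gt0.
congr *%E; rewrite expRE -EFin_lim; last first.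
  rewrite /pseries/=; under eq_fun do rewrite mulrC.
  exact: is_cvg_series_exp_coeff.
apply/congr_lim/funext => n/=; rewrite /pseries/= /series/= -sumEFin//.
by under [RHS]eq_bigr do rewrite mulrC.
Qed.

HB.instance Definition _ := Measure_isProbability.Build _ _ _ heat heat_setT.

End heat_semigroup.

(* D(mu || nu). The value of the integrand at points where the density
   vanishes (lne 0 = -oo) is irrelevant, since these form a mu-null set. *)
Definition relative_entropy d (V : measurableType d) (R : realType)
    (mu nu : probability V R) : \bar R :=
  if `[< mu `<< nu >] then
    \int[mu]_z lne (('d (charge_of_finite_measure mu) '/d nu) z)
  else +oo.

Section markov_kernel.
Context d (V : measurableType d) (R : realType).
Variable P : R.-pker V ~> V.

Definition irreducible : Prop :=
  forall x y, exists k, 0 < kpow P k x [set y].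

Definition reversible_measure (m : V -> R) : Prop :=
  (forall x, (0 < m x)%R) /\
  (forall x y, (m x)%:E * P x [set y] = (m y)%:E * P y [set x]).

(* Irreducibility is an argument because it is what makes the minimum exist. *)
Definition dist (irrP : irreducible) (x y : V) : nat := ex_minn (irrP x y).

Definition dball (irrP : irreducible) (x : V) (r : R) : set V :=
  [set y | ((dist irrP x y)%:R <= r)%R].

Definition LH (irrP : irreducible) (A : R) : Prop :=
  forall (x y : V) (t : {nonneg R}), (0 < t%:num)%R ->
    relative_entropy (heat P t x) (heat P t y) <=
    (A * ((dist irrP x y)%:R ^+ 2 / t%:num +
          (dist irrP x y)%:R / Num.sqrt t%:num))%:E.

End markov_kernel.

Definition Vol (V : choiceType) (R : realType) (m : V -> R) (S : set V) :
  \bar R := \esum_(z in S) (m z)%:E.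

(* Main.v *)
Require Import Defs.
From mathcomp Require Import lra.
From mathcomp Require Import all_boot all_order all_algebra.
From mathcomp Require Import all_classical all_reals all_analysis.

(** Fix [x] and [r], let [S = B(x, r)], and run the heat semigroup up to time
    [t = max(1, delta * r ^ 2)] with a small constant [delta].

    At that time the chain started at [x] is in [S] with probability at least
    [e^-1].  If [t = delta * r ^ 2], the moment bound and Markov's inequality
    give probability at least [1/2], [delta] being chosen for this
    ([heat_ball_ge_half]); if [t = 1], no jump has occurred with probability
    [e^-1] ([heat_start_ge]).

    A point [y] of [B(x, 2 * r)] has [dist(x, y) / sqrt t <= 2 / sqrt delta] in
    both cases, so that [LH] bounds the relative entropy of [P_t(x, .)] with
    respect to [P_t(y, .)] by a constant that does not depend on the scale.  A
    set of non-negligible mass for the first measure then cannot be negligible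
    for the second ([entropy_set_lower_bound]): [P_t(y, S) >= c] for a constant
    [c > 0].

    On the other hand, reversibility makes [m] subinvariant under [P], hence
    under [P_t] ([heat_subinvariant]).  Therefore
    [c * Vol(B(x, 2 * r)) <= \sum_y m(y) P_t(y, S) <= Vol(S)], which is the
    claim with [C_V = 1 / c]. *)

Set Implicit Arguments.
Unset Strict Implicit.
Unset Printing Implicit Defensive.

Import Order.TTheory GRing.Theory Num.Theory.

Local Open Scope classical_set_scope.
Local Open Scope ring_scope.
Local Open Scope ereal_scope.
Local Open Scope charge_scope.

(** * Sums of nonnegative extended reals *)

Lemma ge0_esumZl (R : realType) (T : choiceType) (I : set T) (r : R)
    (a : T -> \bar R) :
  (0 <= r)%R -> (forall i, 0 <= a i) ->
  \esum_(i in I) (r%:E * a i) = r%:E * \esum_(i in I) a i.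
Proof.
have half (s : R) (b : T -> \bar R) : (0 <= s)%R -> (forall i, 0 <= b i) ->
    \esum_(i in I) (s%:E * b i) <= s%:E * \esum_(i in I) b i.
  move=> s0 b0; apply: ge_ereal_sup => _ [X [finX XI] <-].
  rewrite -ge0_mule_fsumr// lee_wpmul2l ?lee_fin//.
  by apply: esum_ge; exists X.
rewrite le_eqVlt => /predU1P[<- a0|r0 a0].
  by rewrite mul0e esum1// => i _; rewrite mul0e.
apply/eqP; rewrite eq_le half ?(ltW r0)//= muleC -lee_pdivlMr// muleC.
rewrite [leLHS](_ : _ = \esum_(i in I) (r^-1%:E * (r%:E * a i))).
  by apply: half => [|i]; rewrite ?invr_ge0 ?mule_ge0// ?lee_fin ltW.
by apply: eq_esum => i _; rewrite muleA -EFinM mulVf ?gt_eqF// mul1e.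
Qed.

Lemma esum_exchange (R : realType) (T1 T2 : choiceType)
    (a : T1 -> T2 -> \bar R) :
  (forall i j, 0 <= a i j) ->
  \esum_(i in [set: T1]) \esum_(j in [set: T2]) a i j =
  \esum_(j in [set: T2]) \esum_(i in [set: T1]) a i j.
Proof.
move=> a0; rewrite !esum_esum//; symmetry.
apply: (@reindex_esum _ _ _ _ _ (fun k : T1 * T2 => (k.2, k.1))
  (fun k : T2 * T1 => a k.2 k.1)).
split=> [[]//|[i1 j1] [i2 j2] _ _ [-> ->]//|[j i] _].
by exists (i, j).
Qed.

(** * Integration on a countable discrete space *)

Section countable_discrete.
Context d (V : measurableType d) (R : realType).
Hypothesis V_countable : countable [set: V].
Hypothesis V_discrete : forall S : set V, measurable S.

Lemma integral_singleton (mu : {measure set V -> \bar R}) (f : V -> \bar R) z :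
  \int[mu]_(y in [set z]) f y = f z * mu [set z].
Proof.
rewrite (eq_integral (cst (f z))) ?integral_cst//.
by move=> y; rewrite inE /= => ->.
Qed.

(** A countable space is the disjoint union of the fibres of an injection into
    [nat], each of which is empty or a singleton. *)
Lemma ge0_integral_atoms (mu : {measure set V -> \bar R}) (f : V -> \bar R) :
  (forall z, 0 <= f z) ->
  \int[mu]_z f z = \esum_(z in [set: V]) (f z * mu [set z]).
Proof.
move=> f0; have [e e_inj] := countable_injP _ V_countable.
have {}e_inj : injective e by move=> a b; apply: e_inj; rewrite inE.
pose F n := [set z | e z = n].
have FT : \bigcup_n F n = [set: V].
  by apply/seteqP; split=> // z _; exists (e z).
have tF : trivIset setT F by move=> i j _ _ [z [<- <-]].
rewrite -FT ge0_integral_bigcup//.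
rewrite esum_bigcupT//; last by move=> z; rewrite mule_ge0.
rewrite nneseries_esumT; last by move=> n; exact: integral_ge0.
apply: eq_esum => n _.
have [[z zn]|Fn] := pselect (exists z, F n z).
  have -> : F n = [set z].
    by apply/seteqP; split=> [y yn|y ->//]; apply: e_inj; rewrite zn yn.
  by rewrite integral_singleton esum_set1// mule_ge0.
have -> : F n = set0 by rewrite -subset0 => y yn; apply: Fn; exists y.
by rewrite integral_set0 esum_set0.
Qed.

(** The two measures may differ: this is how a change of density is carried
    out below. *)
Lemma ge0_le_integral_atoms (mu nu : {measure set V -> \bar R})
    (f g : V -> \bar R) :
  (forall z, 0 <= f z) -> (forall z, 0 <= g z) ->
  (forall z, f z * mu [set z] <= g z * nu [set z]) ->
  \int[mu]_z f z <= \int[nu]_z g z.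
Proof. by move=> f0 g0 fg; rewrite !ge0_integral_atoms//; exact: le_esum. Qed.

(** The positive and the negative parts are compared separately, so that [f] and
    [g] may take infinite values and have infinite integrals, as can happen for
    the logarithm of a density. *)
Lemma le_integral_atoms (mu : {measure set V -> \bar R}) (f g : V -> \bar R) :
  (forall z, mu [set z] != 0 -> f z <= g z) ->
  \int[mu]_z f z <= \int[mu]_z g z.
Proof.
move=> fg; rewrite integralE [leRHS]integralE.
apply: leeB; apply: ge0_le_integral_atoms => // z;
  have [->|/fg fgz] := eqVneq (mu [set z]) 0; rewrite ?mule0// lee_wpmul2r//.
- by rewrite !funeposE ge_max !le_max fgz lexx orbT.
- by rewrite !funenegE ge_max !le_max leeN2 fgz lexx orbT.
Qed.

(** * Relative entropy and the mass of a set *)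

(** At an atom of [mu] the density is [f = mu {z} / nu {z}], and [ln] lies below
    its tangents: [ln (a / f) <= a / f - 1]. *)
Lemma lne_density_ge (mu nu : probability V R) (a : R) (z : V) :
  mu `<< nu -> mu [set z] != 0 -> (0 < a)%R ->
  (1 + ln a - a * (fine (nu [set z]) / fine (mu [set z])))%:E <=
  lne (('d (charge_of_finite_measure mu) '/d nu) z).
Proof.
move=> munu muz0 a0.
have dom : charge_of_finite_measure mu `<< nu by [].
set F := Radon_Nikodym _ _ z.
have FE : (fine F)%:E = F by rewrite fineK//; exact: Radon_Nikodym_fin_num.
have muE : (fine (mu [set z]))%:E = mu [set z].
  by rewrite fineK// fin_num_measure.
have nuE : (fine (nu [set z]))%:E = nu [set z].
  by rewrite fineK// fin_num_measure.
have : (fine (mu [set z]))%:E = (fine F)%:E * (fine (nu [set z]))%:E.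
  by rewrite FE muE nuE -integral_singleton -(Radon_Nikodym_integral dom).
have := fine_ge0 (measure_ge0 nu [set z]).
have := fine_ge0 (measure_ge0 mu [set z]).
rewrite -FE; rewrite -muE eqe in muz0.
move: muz0.
move: (fine (mu _)) (fine (nu _)) (fine F) => p n f p_neq0 p0 n0 [pE].
have {}p0 : (0 < p)%R by rewrite lt_neqAle eq_sym p_neq0.
have {}n0 : (0 < n)%R.
  rewrite lt_neqAle n0 andbT; apply/eqP => n00.
  by rewrite pE -n00 mulr0 ltxx in p0.
have f0 : (0 < f)%R by rewrite -(pmulr_lgt0 _ n0) -pE.
rewrite lne_EFin// lee_fin.
have -> : (n / p = f^-1)%R by rewrite pE invfM mulrCA divff ?gt_eqF// mulr1.
have af0 : (0 < a / f)%R by rewrite divr_gt0.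
have := @le_ln1Dx _ (a / f - 1)%R.
rewrite ltrBrDl subrr addrC subrK => /(_ af0).
by rewrite ln_div//; lra.
Qed.

(** Integrating against [mu] the tangent bound with parameter [a] on [S]
    and [1] off [S] gives
    [D >= (1 + ln a) * mu S - a * nu S - 1].
    The choice [(1 + ln a) * p = D + 2] makes this [a * nu S >= 1]. *)
Lemma entropy_set_lower_bound (mu nu : probability V R) (S : set V) (D p : R) :
  (0 < p)%R -> (0 <= D)%R -> p%:E <= mu S ->
  relative_entropy mu nu <= D%:E ->
  (expR (1 - (D + 2) / p))%:E <= nu S.
Proof.
move=> p0 D0 pS; rewrite /relative_entropy; case: ifPn => // /asboolP munu.
set F := fun z => lne _ => FD.
pose b : R := ((D + 2) / p)%R.
have b0 : (0 <= b)%R by rewrite divr_ge0 ?(ltW p0)// addr_ge0.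
pose a : R := expR (b - 1).
have a0 : (0 < a)%R by exact: expR_gt0.
(* [k - w] is the lower bound for [F], with the constant 1 dropped off [S]; it
   is split because [k] is bounded and [w] is controlled through [nu]. *)
pose k z := b%:E * (\1_S z)%:E.
pose w z := ((if z \in S then a else 1) *
  (fine (nu [set z]) / fine (mu [set z])))%R%:E.
have w0 z : 0 <= w z.
  rewrite lee_fin mulr_ge0 ?divr_ge0 ?fine_ge0//.
  by case: ifP => // _; exact: ltW.
have kI : mu.-integrable [set: V] k.
  by apply: integrableZl => //; exact: integrable_indic.
have kE : \int[mu]_z k z = b%:E * mu S.
  rewrite integralZl// ?integral_indic ?setIT//.
  exact: integrable_indic.
have wE : \int[mu]_z w z <= a%:E * nu S + 1.
  rewrite (_ : _ + 1 = \int[nu]_z (a%:E * (\1_S z)%:E + 1)); last first.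
    rewrite ge0_integralD//; last by move=> z _; rewrite mule_ge0// lee_fin ltW.
    rewrite integralZl ?integral_indic ?setIT//; last exact: integrable_indic.
    rewrite integral_cst// mul1e; congr (_ + _).
    exact: (esym (probability_setT nu)).
  apply: ge0_le_integral_atoms => // [z|z].
    by rewrite adde_ge0// mule_ge0// lee_fin ltW.
  have mufin : mu [set z] \is a fin_num by exact: fin_num_measure.
  have nufin : nu [set z] \is a fin_num by exact: fin_num_measure.
  rewrite -[X in _ * X <= _](fineK mufin) -[X in _ <= _ * X](fineK nufin).
  have := fine_ge0 (measure_ge0 nu [set z]).
  rewrite /w indicE; move: (fine (mu _)) (fine (nu _)) => p' n n0.
  rewrite -[leLHS]EFinM -[X in X + 1]EFinM -EFinD -[leRHS]EFinM lee_fin.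
  (* At a [mu]-null atom [w] is 0, by the convention [0^-1 = 0]. *)
  have [->|p'0] := eqVneq p' 0%R.
    by rewrite mulr0 mulr_ge0// addr_ge0// mulr_ge0// ltW.
  rewrite -mulrA divfK// ler_wpM2r//.
  by case: (z \in S); rewrite ?mulr1 ?mulr0; lra.
have nuS : nu S \is a fin_num by exact: fin_num_measure.
have wI : mu.-integrable [set: V] w.
  apply/integrableP; split => //.
  under eq_integral do rewrite gee0_abs//.
  apply: le_lt_trans wE _.
  by rewrite ltey_eq fin_numD fin_numM.
have : \int[mu]_z (k z - w z) <= D%:E.
  apply: le_trans FD; apply: le_integral_atoms => // z muz.
  rewrite /k /w /F indicE; case: ifPn => _ /=.
    apply: le_trans (lne_density_ge munu muz a0).
    by rewrite -EFinM -EFinB lee_fin mulr1 /a expRK addrCA subrr addr0.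
  apply: le_trans (lne_density_ge munu muz ltr01).
  by rewrite mule0 -EFinB lee_fin ln1 addr0 lerD2r.
rewrite integralB// kE => le1.
have : (D + 2)%:E - (a%:E * nu S + 1) <= D%:E.
  apply: le_trans le1; apply: leeB => //.
  rewrite (_ : (D + 2)%:E = b%:E * p%:E); first exact: lee_wpmul2l.
  by rewrite -EFinM /b divfK ?gt_eqF.
move: nuS; case: (nu S) => // q _.
rewrite -EFinM -(EFinD _ 1) -EFinB !lee_fin.
have -> : (1 - b = - (b - 1))%R by rewrite opprB.
rewrite expRN -/a => h.
rewrite -[leLHS]mulr1 mulrC ler_pdivrMr//; lra.
Qed.

End countable_discrete.

(** * Subinvariance of the reversible measure *)

Lemma heat_series d (V : measurableType d) (R : realType) (P : R.-pker V ~> V)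
    (t : {nonneg R}) (x : V) (U : set V) :
  heat P t x U =
  \sum_(k <oo) (expR (- t%:num) * (t%:num ^+ k / k`!%:R))%:E * kpow P k x U.
Proof.
rewrite /heat /mscale /= /mseries -nneseriesZl//.
by apply: eq_eseriesr => k _; rewrite /mscale /= muleA -EFinM.
Qed.

Section invariance.
Context d (V : measurableType d) (R : realType).
Hypothesis V_countable : countable [set: V].
Hypothesis V_discrete : forall S : set V, measurable S.
Variables (P : R.-pker V ~> V) (m : V -> R).
Hypothesis revP : reversible_measure P m.

(** Detailed balance turns the sum into [m z * P z [set: V]]. *)
Lemma reversible_subinvariant z :
  \esum_(y in [set: V]) ((m y)%:E * P y [set z]) <= (m z)%:E.
Proof.
have [m0 Pm] := revP.
under eq_esum do rewrite Pm.
rewrite ge0_esumZl ?(ltW (m0 z))//.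
rewrite -[leRHS]mule1 lee_wpmul2l ?lee_fin ?(ltW (m0 z))//.
rewrite -(@prob_kernel _ _ _ _ _ P z) -[leRHS]mul1e -integral_cst//.
rewrite ge0_integral_atoms//.
by apply: le_esum => y _; rewrite mul1e.
Qed.

(** By Tonelli, one step of the chain started from [m] can be summed first, and
    the remaining [k] steps are then started from a measure that is at most
    [m]. *)
Lemma kpow_subinvariant k (S : set V) :
  \esum_(y in [set: V]) ((m y)%:E * kpow P k y S) <= Vol m S.
Proof.
have [m0 Pm] := revP.
elim: k S => [|k IH] S.
  rewrite /Vol [leRHS]esum_mkcond; apply: le_esum => y _ /=.
  rewrite /kdirac diracE; case: ifP; rewrite ?mule1 ?mule0//.
apply: le_trans (IH S).
rewrite (eq_esum (b := fun y => \esum_(z in [set: V])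
    ((m y)%:E * (kpow P k z S * P y [set z])))); last first.
  move=> y _ /=; rewrite /mkcomp_noparam /= /kcomp_noparam ge0_integral_atoms//.
  by rewrite ge0_esumZl ?(ltW (m0 y))// => z; exact: mule_ge0.
rewrite esum_exchange; last first.
  by move=> y z; rewrite !mule_ge0// lee_fin ltW.
apply: le_esum => z _.
rewrite muleC.
have Pfin : kpow P k z S \is a fin_num.
  rewrite ge0_fin_numE//; apply: le_lt_trans (ltry 1).
  rewrite -(@prob_kernel _ _ _ _ _ (kpow P k) z).
  by apply: le_measure; rewrite ?inE.
rewrite (eq_esum (b := fun y =>
    (fine (kpow P k z S))%:E * ((m y)%:E * P y [set z]))); last first.
  by move=> y _; rewrite fineK// muleCA.
rewrite ge0_esumZl ?fine_ge0//; last first.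
  by move=> y; rewrite mule_ge0// lee_fin ltW.
by rewrite fineK// lee_wpmul2l// reversible_subinvariant.
Qed.

Lemma heat_subinvariant (t : {nonneg R}) (S : set V) :
  \esum_(y in [set: V]) ((m y)%:E * heat P t y S) <= Vol m S.
Proof.
have [m0 Pm] := revP.
have Vol0 : 0 <= Vol m S by apply: esum_ge0 => y _; rewrite lee_fin ltW.
pose c k : R := (expR (- t%:num) * (t%:num ^+ k / k`!%:R))%R.
have c0 k : (0 <= c k)%R by rewrite mulr_ge0 ?expR_ge0// divr_ge0// exprn_ge0.
have heatE y U : heat P t y U = \sum_(k <oo) (c k)%:E * kpow P k y U.
  exact: heat_series.
have [Voly|] := eqVneq (Vol m S) +oo; first by rewrite Voly leey.
rewrite -ltey => Volfin.
rewrite (eq_esum (b := fun y => \esum_(k in [set: nat])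
    ((c k)%:E * ((m y)%:E * kpow P k y S)))); last first.
  move=> y _; rewrite heatE nneseries_esumT; last first.
    by move=> k; rewrite mule_ge0// lee_fin.
  rewrite -ge0_esumZl ?(ltW (m0 y))//.
    by apply: eq_esum => k _; rewrite muleCA.
  by move=> k; rewrite mule_ge0// lee_fin.
rewrite esum_exchange; last by move=> y k; rewrite !mule_ge0// lee_fin// ltW.
(* The Poisson weights sum to 1, being the total mass of a heat measure. *)
have -> : Vol m S = \esum_(k in [set: nat]) ((fine (Vol m S))%:E * (c k)%:E).
  rewrite ge0_esumZl ?fine_ge0// fineK ?ge0_fin_numE//.
  have -> : \esum_(k in [set: nat]) (c k)%:E = heat P t point [set: V].
    rewrite heatE nneseries_esumT; last by move=> k; rewrite mule_ge0// lee_fin.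
    by apply: eq_esum => k _; rewrite (@prob_kernel _ _ _ _ _ (kpow P k)) mule1.
  by rewrite (probability_setT (heat P t point)) mule1.
apply: le_esum => k _.
rewrite ge0_esumZl//; last by move=> y; rewrite mule_ge0// lee_fin ltW.
rewrite muleC fineK; last by rewrite ge0_fin_numE.
by rewrite lee_wpmul2r ?lee_fin// kpow_subinvariant.
Qed.

End invariance.

(** * Mass of a ball under the heat semigroup *)

Lemma distxx d (V : measurableType d) (R : realType) (P : R.-pker V ~> V)
  (irrP : irreducible P) (x : V) : dist irrP x x = 0%N.
Proof.
rewrite /dist; case: ex_minnP => k _ /(_ 0%N) /= h.
by apply/eqP; rewrite -leqn0 h// /kdirac diracE mem_set.
Qed.

(** The term [k = 0] of the series: the chain has not jumped by time [t]. *)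
Lemma heat_start_ge d (V : measurableType d) (R : realType)
    (P : R.-pker V ~> V) (t : {nonneg R}) (x : V) (U : set V) :
  U x -> (expR (- t%:num))%:E <= heat P t x U.
Proof.
move=> Ux; rewrite heat_series.
apply: le_trans (nneseries_lim_ge 1 _); last first.
  move=> k _ _; rewrite mule_ge0// lee_fin mulr_ge0 ?expR_ge0//.
rewrite big_nat1 /= /kdirac diracE mem_set// mule1.
by rewrite expr0 fact0 divr1 mulr1.
Qed.

(** Markov's inequality for [dist(x, .) ^ alpha]. *)
Lemma heat_ball_ge_half d (V : measurableType d) (R : realType)
    (V_countable : countable [set: V])
    (V_discrete : forall S : set V, measurable S)
    (P : R.-pker V ~> V) (irrP : irreducible P) (alpha : R) (t : {nonneg R})
    (x : V) (r : R) :
  (0 < alpha)%R -> (0 < r)%R ->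
  'E_(heat P t x)[fun y => ((dist irrP x y)%:R `^ alpha)%R] <=
    (r `^ alpha / 2)%R%:E ->
  (2^-1)%:E <= heat P t x (dball irrP x r).
Proof.
move=> alpha0 r0; rewrite unlock => Er.
set B := dball irrP x r.
have ra0 : (0 < r `^ alpha)%R by exact: powR_gt0.
have : (r `^ alpha)%:E * heat P t x (~` B) <= (r `^ alpha / 2)%R%:E.
  apply: le_trans Er.
  rewrite -[X in heat P t x X]setIT -integral_indic//.
  rewrite -integralZl//; last exact: integrable_indic.
  apply: le_integral_atoms => // z _; rewrite -EFinM lee_fin indicE.
  case: (boolP (z \in ~` B)) => [|_]; last by rewrite mulr0 powR_ge0.
  rewrite inE /B /dball /= => /negP; rewrite -ltNge => rz.
  rewrite mulr1 ge0_ler_powR ?nnegrE//; exact: ltW.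
have -> : heat P t x (~` B) = 1 - heat P t x B by exact: probability_setC.
have : heat P t x B \is a fin_num by exact: fin_num_measure.
case: (heat P t x B) => // q _.
rewrite -[1 - _]/((1 - q)%:E) -EFinM !lee_fin ler_pM2l//; lra.
Qed.

(** * Volume doubling *)

Theorem theorem2p5 (R : realType) (A alpha K : R) (alpha_gt0 : (0 < alpha)%R) :
  exists CV : R,
    forall (d : measure_display) (V : measurableType d)
      (V_countable : countable [set: V])
      (V_discrete : forall S : set V, measurable S)
      (P : R.-pker V ~> V) (m : V -> R) (irrP : irreducible P),
      reversible_measure P m ->
      LH irrP A ->
      (forall t : {nonneg R}, (1 <= t%:num)%R ->
        ereal_sup [set 'E_(heat P t x)[fun y => ((dist irrP x y)%:R `^ alpha)%R]
                  | x in [set: V]]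
        <= (K * t%:num `^ (alpha / 2))%R%:E) ->
      forall (x : V) (r : R), (0 <= r)%R ->
        Vol m (dball irrP x (2 * r)%R) <= CV%:E * Vol m (dball irrP x r).
Proof.
pose K1 : R := Num.max K 1%R.
have K1_gt0 : (0 < K1)%R by rewrite /K1 lt_max ltr01 orbT.
(* [e = sqrt delta]: the moment bound at time [(e * r) ^ 2] is
   [K * e ^ alpha * r ^ alpha], at most half of [r ^ alpha]. *)
pose e : R := ((2 * K1)^-1 `^ alpha^-1)%R.
have e0 : (0 < e)%R by rewrite powR_gt0// invr_gt0 mulr_gt0.
have eE : (e `^ alpha = (2 * K1)^-1)%R.
  by rewrite /e -powRrM mulVf ?gt_eqF// powRr1// invr_ge0 mulr_ge0// ltW.
pose D : R := (`|A| * ((2 / e) ^+ 2 + 2 / e))%R.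
have D0 : (0 <= D)%R.
  by rewrite mulr_ge0// addr_ge0// ?sqr_ge0// divr_ge0// ltW.
pose p : R := expR (- 1).
have p0 : (0 < p)%R by exact: expR_gt0.
pose c : R := expR (1 - (D + 2) / p).
have c0 : (0 < c)%R by exact: expR_gt0.
exists c^-1%R => d V Vc Vd P m irrP revP lh mom x r r0.
have [m0 _] := revP.
set S := dball irrP x r.
have Sx : S x by rewrite /S /dball /= distxx.
(* [s = max(1, e * r)] is the square root of the time. *)
have [s [s1 ers heatS]] : exists s : R, [/\ (1 <= s)%R, (e * r <= s)%R &
    forall t : {nonneg R}, t%:num = (s ^+ 2)%R -> p%:E <= heat P t x S].
  have [er1|er1] := ltP (e * r)%R 1%R.
    exists 1%R; split => //; first exact: ltW.
    move=> t; rewrite expr1n => t1.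
    by rewrite /p -t1; exact: heat_start_ge.
  exists (e * r)%R; split => // t tE.
  have r_gt0 : (0 < r)%R.
    by rewrite -(pmulr_rgt0 _ e0); exact: lt_le_trans er1.
  apply: (@le_trans _ _ (2^-1)%:E).
    rewrite lee_fin /p expRN lef_pV2 ?posrE ?expR_gt0//.
    by have := expR_ge1Dx (1 : R).
  apply: (heat_ball_ge_half Vc Vd alpha_gt0 r_gt0).
  have t1 : (1 <= t%:num)%R by rewrite tE exprn_ege1.
  apply: (@le_trans _ _ (K * t%:num `^ (alpha / 2))%R%:E).
    by apply: le_trans (mom t t1); apply: ereal_sup_ubound; exists x.
  rewrite lee_fin tE -powR_mulrn ?mulr_ge0 ?(ltW e0)//.
  rewrite -powRrM mulrCA divff// mulr1 powRM ?(ltW e0)// eE.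
  rewrite mulrA mulrC ler_pM2l ?powR_gt0// invfM mulrCA.
  rewrite -[leRHS]mulr1 ler_pM2l// ler_pdivrMr// mul1r.
  by rewrite /K1 le_max lexx.
have s0 : (0 < s)%R by exact: lt_le_trans s1.
pose t : {nonneg R} := NngNum (sqr_ge0 s).
have heatyS y : dball irrP x (2 * r)%R y -> c%:E <= heat P t y S.
  move=> yB; apply: (entropy_set_lower_bound Vc Vd p0 D0 (heatS t erefl)).
  apply: (le_trans (lh x y t _)); first by rewrite /= exprn_gt0.
  rewrite lee_fin /= sqrtr_sqr (gtr0_norm s0).
  set n : R := (dist irrP x y)%:R.
  have ns : (n / s <= 2 / e)%R.
    rewrite ler_pdivrMr// mulrAC ler_pdivlMr//.
    have : (n <= 2 * r)%R by exact: yB.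
    by rewrite -(ler_pM2r e0); lra.
  have n0 : (0 <= n / s)%R by rewrite divr_ge0// ltW.
  rewrite -expr_div_n /D.
  apply: (@le_trans _ _ (`|A| * ((n / s) ^+ 2 + n / s))%R).
    by rewrite ler_wpM2r ?ler_norm// addr_ge0// sqr_ge0.
  rewrite ler_wpM2l// lerD// ler_pXn2r// nnegrE//.
  by rewrite divr_ge0// ltW.
rewrite muleC lee_pdivlMr// muleC.
rewrite -ge0_esumZl ?(ltW c0)//; last by move=> y; rewrite lee_fin ltW.
apply: le_trans (heat_subinvariant Vc Vd revP t S).
rewrite esum_mkcond; apply: le_esum => y _.
case: ifPn => [|_]; last by rewrite mule_ge0// lee_fin ltW.
rewrite inE => /heatyS cS.
by rewrite muleC lee_wpmul2l// lee_fin ltW.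
Qed.
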